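(* Suppose $(d_1,d_2,d_3,d_4) \in (\mathbb{N}^+)^4$ is well-formed, let $\Gamma = \langle d_1, d_2, d_3, d_4 \rangle \subseteq \mathbb{N}$ be the numerical semigroup generated by $d_1,d_2,d_3,d_4$, and let $L = \operatorname{lcm}(d_1, d_2, d_3, d_4)$. (i) If $N$ is an integer with $N \geq \max\{ 2L-\sum_{m=1}^4 d_m,\ 0 \}$, then $N \in \Gamma$. (ii) If $n \in \mathbb{N}^+$ and $n L - \sum_{i=1}^4 d_i \in \mathbb{N} \setminus \Gamma$, then $n=1$ and the set $\{ d_1, d_2 , d_3 , d_4 \}$ has exactly $2$ elements.
   Context: $\mathbb{N}$ denotes the natural numbers including $0$, and $\mathbb{N}^+$ the positive integers. A tuple $(d_1,\dots,d_n)\in(\mathbb{N}^+)^n$ is well-formed if for every $i\in\{1,\dots,n\}$ the gcd of the $n-1$ entries obtained by removing $d_i$ equals $1$. $\langle d_1,\dots,d_n\rangle$ denotes the submonoid of $(\mathbb{N},+)$ generated by $d_1,\dots,d_n$. *)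

(* Defs.v *)
From mathcomp Require Import all_boot all_order all_algebra.

Set Implicit Arguments.
Unset Strict Implicit.
Unset Printing Implicit Defensive.

Definition well_formed (n : nat) (d : n.-tuple nat) : Prop :=
  forall i : 'I_n, \big[gcdn/0]_(j < n | j != i) tnth d j = 1.

(* The submonoid of (nat, +) generated by the entries of [s]. *)
Inductive generated (s : seq nat) : nat -> Prop :=
| generated_mem x : x \in s -> generated s x
| generated_zero : generated s 0
| generated_add x y : generated s x -> generated s y -> generated s (x + y).

(* Main.v *)
Require Import Defs.
From mathcomp Require Import all_boot all_order all_algebra.
From mathcomp Require Import zify.

Set Implicit Arguments.
Unset Strict Implicit.
Unset Printing Implicit Defensive.

(* Assume that 1 is not a generator. Split the generators into two pairs {a,
   b}, {c, e}, with coprime gcds g, h. A multiple of g exceeding lcm(a, b) is a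
   combination of a and b with positive coefficients, so m lies in the
   semigroup as soon as m + a + b + c + e = X + Y with g | X > lcm(a, b) and h
   | Y > lcm(c, e). Put lcm(a, b) = g P and lcm(c, e) = h Q, so that L = g h
   lcm(P, Q). If m + a + b + c + e >= 2 L, a suitable X is found by the Chinese
   remainder theorem unless g = h = 1 and P = Q. If it equals L, then X = g h k
   works for k = floor(P / h) + 1 unless P = Q = 1 (that is, a = b and c = e),
   or g = 1 and P | Q, or h = 1 and Q | P. If all three pairings fail through
   coprimality, the three coprime pairs form either a star, whose centre is
   then 1, or a triangle, whose lcm then divides the fourth generator, so that
   L is less than the sum of the generators. *)

(** * Positive combinations of two generators and the splitting criterion *)

Lemma generated_muln s k x : x \in s -> generated s (k * x).
Proof.
move=> xs; elim: k => [|k IH]; first exact: generated_zero.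
by rewrite mulSn; apply: generated_add IH; apply: generated_mem.
Qed.

Lemma crt_window x y r l : 0 < x -> 0 < y -> coprime x y ->
  exists T, [/\ l < T, T <= l + x * y, x %| T & T = r %[mod y]].
Proof.
move=> x0 y0 cxy; have xy0 : 0 < x * y by rewrite muln_gt0 x0.
set z := chinese x y 0 r.
(* The summand [l.+1 * (x * y)] keeps the truncated subtraction exact, so that [T] is congruent to
   [z]. *)
pose T := l.+1 + (z + l.+1 * (x * y) - l.+1) %% (x * y).
have Tz : T = z %[mod x * y].
  rewrite /T modnDmr subnKC ?modnMDl; last by nia.
  by rewrite addnC modnMDl.
have := ltn_pmod (z + l.+1 * (x * y) - l.+1) xy0; rewrite -/T => lt_xy.
exists T; split; [by rewrite /T; lia | by rewrite /T; lia | |].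
- rewrite /dvdn -(modn_dvdm T (dvdn_mulr y (dvdnn x))) Tz.
  by rewrite modn_dvdm ?dvdn_mulr // chinese_modl // mod0n.
- rewrite -(modn_dvdm T (dvdn_mull x (dvdnn y))) Tz.
  by rewrite modn_dvdm ?dvdn_mull // chinese_modr.
Qed.

(** After division by the gcd, take a multiple [T] of [x] with 0 < [T] <= [x * y], congruent to [Z]
    modulo [y]; as [Z] exceeds [x * y], the rest [Z - T] is a positive multiple of [y]. *)
Lemma positive_combination a b X : 0 < a -> 0 < b ->
  gcdn a b %| X -> lcmn a b < X -> exists u v, X = u.+1 * a + v.+1 * b.
Proof.
move=> a0 b0; have g0 : 0 < gcdn a b by rewrite gcdn_gt0 a0.
have := muln_lcm_gcd a b; set g := gcdn a b in g0 *.
move=> lg /dvdnP[Z ->].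
have [x ax] : exists x, a = x * g by apply/dvdnP; apply: dvdn_gcdl.
have [y by_] : exists y, b = y * g by apply/dvdnP; apply: dvdn_gcdr.
have cxy : coprime x y.
  by rewrite /coprime -(eqn_pmul2r g0) mul1n muln_gcdl -ax -by_.
have x0 : 0 < x by lia.
have y0 : 0 < y by lia.
have -> : lcmn a b = x * y * g.
  by apply/eqP; rewrite -(eqn_pmul2r g0) lg ax by_; apply/eqP; lia.
rewrite ltn_pmul2r // => xyZ.
have [T [T0 Txy /dvdnP[u Tu] TZ]] := crt_window Z 0 x0 y0 cxy.
have TltZ : T < Z by lia.
have /dvdnP[v Zv] : y %| Z - T by rewrite -eqn_mod_dvd ?TZ // ltnW.
have u0 : 0 < u by nia.
have v0 : 0 < v by nia.
by exists u.-1, v.-1; rewrite !prednK // ax by_; nia.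
Qed.

(** Positive coefficients leave room to subtract one copy of each generator. *)
Lemma generated_split s a b c e m X Y :
  [/\ 0 < a, 0 < b, 0 < c & 0 < e] ->
  [/\ a \in s, b \in s, c \in s & e \in s] ->
  m + (a + b + c + e) = X + Y ->
  gcdn a b %| X -> lcmn a b < X -> gcdn c e %| Y -> lcmn c e < Y ->
  generated s m.
Proof.
move=> [a0 b0 c0 e0] [a_s b_s c_s e_s] mE gX lX gY lY.
have [u [v Xuv]] := positive_combination a0 b0 gX lX.
have [w [z Ywz]] := positive_combination c0 e0 gY lY.
have -> : m = (u * a + v * b) + (w * c + z * e) by lia.
by do 2?[apply: generated_add]; apply: generated_muln.
Qed.

(** * Arithmetic of the two lcms *)

Definition coprime3 x y z := coprime (gcdn x y) z.

Lemma lcm_coprime_quotient a b h : 0 < a -> 0 < b ->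
  coprime h a -> coprime h b ->
  exists2 P, lcmn a b = gcdn a b * P & 0 < P /\ coprime P h.
Proof.
move=> a0 b0 ha hb.
have /dvdnP[P lP] : gcdn a b %| lcmn a b.
  by apply: dvdn_trans (dvdn_gcdl _ _) (dvdn_lcml _ _).
exists P; first by rewrite mulnC.
have l0 : 0 < lcmn a b by rewrite lcmn_gt0 a0.
split; first by case: P lP l0 => // ->.
rewrite coprime_sym; apply: (@coprime_dvdr _ (a * b)); last by rewrite coprimeMr ha.
by rewrite -muln_lcm_gcd lP dvdn_mulr ?dvdn_mulr.
Qed.

Lemma lcm_coprime_ge6 a b : 1 < a -> 1 < b -> coprime a b -> 6 <= lcmn a b.
Proof.
move=> a1 b1 cab; have := muln_lcm_gcd a b; rewrite (eqP cab) muln1 => ->.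
have : ~ (a = 2 /\ b = 2) by move=> [aE bE]; move: cab; rewrite aE bE.
by nia.
Qed.

(* In the notation of the header, [P = m * s] and [Q = m * t] with [m] their gcd. *)
Lemma lcm_pair_decomposition a b c e :
  [/\ 1 < a, 1 < b, 1 < c & 1 < e] ->
  [/\ coprime3 a b c, coprime3 a b e, coprime3 c e a & coprime3 c e b] ->
  let g := gcdn a b in let h := gcdn c e in
  exists m s t,
    [/\ lcmn a b = g * (m * s), lcmn c e = h * (m * t),
        lcmn (lcmn a b) (lcmn c e) = g * h * (m * s * t) &
        [/\ [/\ 0 < m, 0 < s, 0 < t & coprime s t],
            [/\ coprime g h, coprime (m * s) h & coprime (m * t) g],
            g = 1 -> 6 <= m * s & h = 1 -> 6 <= m * t]].
Proof.
move=> [a1 b1 c1 e1] [abc abe cea ceb] g h.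
have [a0 b0 c0 e0] : [/\ 0 < a, 0 < b, 0 < c & 0 < e] by split; lia.
have [P lP [P0 Ph]] := lcm_coprime_quotient a0 b0 cea ceb.
have [Q lQ [Q0 Qg]] := lcm_coprime_quotient c0 e0 abc abe.
have gh : coprime g h by apply: coprime_dvdr (dvdn_gcdl _ _) abc.
have m0 : 0 < gcdn P Q by rewrite gcdn_gt0 P0.
have [s Ps] : exists s, P = s * gcdn P Q by apply/dvdnP; apply: dvdn_gcdl.
have [t Qt] : exists t, Q = t * gcdn P Q by apply/dvdnP; apply: dvdn_gcdr.
(* Here [g] is coprime to [h] and [Q], and [h] to [P], so both factors drop out of the gcd. *)
have gcdE : gcdn (g * P) (h * Q) = gcdn P Q.
  rewrite Gauss_gcdr; last by rewrite coprimeMl gh.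
  by rewrite gcdnC Gauss_gcdr // gcdnC.
exists (gcdn P Q), s, t; rewrite -/g -/h in lP lQ *.
rewrite lP lQ; split; [lia | lia | |].
  apply/eqP; rewrite -(eqn_pmul2r m0) -{1}gcdE muln_lcm_gcd; apply/eqP; lia.
rewrite ![gcdn P Q * _]mulnC -Ps -Qt; split.
- split; [lia | lia | lia |].
  by rewrite /coprime -(eqn_pmul2r m0) mul1n muln_gcdl -Ps -Qt.
- by split.
- move=> g1; have := lcm_coprime_ge6 a1 b1.
  by rewrite /coprime -/g lP g1 mul1n; apply.
- move=> h1; have := lcm_coprime_ge6 c1 e1.
  by rewrite /coprime -/h lQ h1 mul1n; apply.
Qed.

(** * Inequalities that make room for X and Y *)

Lemma lcm_window g h m s t :
  0 < g -> 0 < h -> [/\ 0 < m, 0 < s, 0 < t & coprime s t] -> coprime g h ->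
  (g = 1 -> 6 <= m * s) -> (h = 1 -> 6 <= m * t) ->
  [/\ g = 1, h = 1, s = 1 & t = 1] \/
  g * (m * s) + h * (m * t) + g * h < 2 * (g * h * (m * s * t)).
Proof.
move=> g0 h0 [m0 s0 t0 cst] cgh g1 h1.
case: (boolP ((g == 1) && (h == 1))) => [/andP[/eqP g1E /eqP h1E]|gh1].
  case: (boolP ((s == 1) && (t == 1))) => [/andP[/eqP sE /eqP tE]|st1].
    by left.
  right; rewrite g1E h1E; have := g1 g1E; have := h1 h1E.
  have : 1 < s \/ 1 < t by lia.
  by case; nia.
right; set W := m * s * t; have [W1|W1] := leqP W 1.
  have [m1 s1 t1] : [/\ m = 1, s = 1 & t = 1] by rewrite /W in W1; split; nia.
  have g2 : 1 < g by case: (ltngtP g 1) => // [|/g1]; lia.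
  have h2 : 1 < h by case: (ltngtP h 1) => // [|/h1]; lia.
  have : ~ (g = 2 /\ h = 2) by move=> [gE hE]; move: cgh; rewrite gE hE.
  by rewrite /W m1 s1 t1; nia.
have PW : m * s <= W by rewrite /W; nia.
have QW : m * t <= W by rewrite /W; nia.
have gh2 : 2 <= g * h by nia.
(* Bounding the first two summands by [(g * h + 1) * W] reduces the claim to ([g * h] - 1)([W] - 1)
   > 1: both factors are positive, and one must exceed 1. *)
have : 2 < W \/ 2 < g * h.
  case: (ltnP 2 W) => [|W2]; first by left.
  right; have g2 : 1 < g by case: (ltngtP g 1) => // [|/g1]; lia.
  have h2 : 1 < h by case: (ltngtP h 1) => // [|/h1]; lia.
  by nia.
have S : g + h <= g * h + 1 by nia.
have : g * (m * s) + h * (m * t) <= (g * h + 1) * W by nia.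
move: (g * h) gh2 => G G2 ? [] ?; nia.
Qed.

Lemma divn_coprime_le k p h : 1 < k -> k <= h -> coprime p h -> 0 < p ->
  k * (p %/ h) + 1 <= p.
Proof.
move=> k1 kh cph p0; have h0 : 0 < h by lia.
have : p %% h != 0.
  apply/negP => hp; move: cph; rewrite coprime_sym /coprime.
  by move/gcdn_idPl: hp => ->; lia.
by have := divn_eq p h; nia.
Qed.

(** The case g = 1 of the floor estimate. Small [h] is tight: for [h = 1] coprimality excludes
    [s = t = 2], for [h = 2] it makes [m] and [s] odd, and from [h = 3] on the quotient is at most a
    third. *)
Lemma floor_window_unit h m s t :
  0 < h -> [/\ 0 < m, 0 < s, 0 < t & coprime s t] -> coprime (m * s) h ->
  6 <= m * s -> 1 < t \/ 1 < h -> 1 < s ->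
  m * s %/ h + m * t + 2 <= m * s * t.
Proof.
move=> h0 [m0 s0 t0 cst] cPh P6 th s1.
have [h1|h1] := leqP h 1.
  have t1 : 1 < t by lia.
  have -> : h = 1 by lia.
  rewrite divn1; have st : ~ (s = 2 /\ t = 2).
    by move=> [sE tE]; move: cst; rewrite sE tE.
  have [m1|m1] := leqP m 1; last first.
    have : s + t + 1 <= s * t by nia.
    by nia.
  have mE : m = 1 by lia.
  by move: P6; rewrite mE; nia.
have [h2|h2] := leqP h 2.
  have hE : h = 2 by lia.
  rewrite hE in cPh *; move: (cPh); rewrite coprimen2 oddM => /andP[om os].
  have s3 : 2 < s by case: (ltngtP s 2) os => // [|->]; lia.
  have := @divn_coprime_le 2 (m * s) 2 isT isT cPh.
  have [m1|m1] := leqP m 1; last first.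
    have m3 : 2 < m by case: (ltngtP m 2) om => // [|->]; lia.
    have : 9 <= m * s * t by nia.
    have : m * t * 3 <= m * s * t by nia.
    have : m * s <= m * s * t by nia.
    by lia.
  have mE : m = 1 by lia.
  have s6 : 6 < s by case: (ltngtP s 6) os P6; rewrite ?mE => //; [lia|move->].
  by rewrite mE; nia.
have := @divn_coprime_le 3 (m * s) h isT h2 cPh.
by nia.
Qed.

(** For k = floor(P / h) + 1 the last alternative reads k + floor(Q / g) + 1 <= [m * s * t], which
    leaves room for both X = g h k and L - X. *)
Lemma floor_window g h m s t :
  0 < g -> 0 < h -> [/\ 0 < m, 0 < s, 0 < t & coprime s t] ->
  [/\ coprime g h, coprime (m * s) h & coprime (m * t) g] ->
  (g = 1 -> 6 <= m * s) -> (h = 1 -> 6 <= m * t) ->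
  [\/ m * s = 1 /\ m * t = 1, g = 1 /\ s = 1, h = 1 /\ t = 1 |
      m * s %/ h + m * t %/ g + 2 <= m * s * t].
Proof.
move=> g0 h0 [m0 s0 t0 cst] [cgh cPh cQg] g1 h1.
have [gE|gN] := eqVneq g 1; have [hE|hN] := eqVneq h 1.
- have [sE|sN] := eqVneq s 1; first by apply: Or42.
  have [tE|tN] := eqVneq t 1; first by apply: Or43.
  apply: Or44; rewrite gE divn1; apply: floor_window_unit => //; lia.
- have [sE|sN] := eqVneq s 1; first by apply: Or42.
  apply: Or44; rewrite gE divn1; apply: floor_window_unit => //; lia.
- have [tE|tN] := eqVneq t 1; first by apply: Or43.
  have := @floor_window_unit g m t s g0 (And4 m0 t0 s0 _) cQg (h1 hE).
  rewrite coprime_sym => /(_ cst) H.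
  by apply: Or44; rewrite hE divn1; lia.
have [W1|W1] := leqP (m * s * t) 1.
  by apply: Or41; split; nia.
apply: Or44.
have P0 : 0 < m * s by nia.
have Q0 : 0 < m * t by nia.
have PW : m * s <= m * s * t by nia.
have QW : m * t <= m * s * t by nia.
(* Bounding both quotients by halves would leave [m * s * t = 3] open; a divisor above 2 improves
   one of them to a third. *)
have : 2 < g \/ 2 < h.
  have : ~ (g = 2 /\ h = 2) by move=> [gE hE]; move: cgh; rewrite gE hE.
  by lia.
have g2 : 1 < g by lia.
have h2 : 1 < h by lia.
have := @divn_coprime_le 2 (m * s) h isT h2 cPh P0.
have := @divn_coprime_le 2 (m * t) g isT g2 cQg Q0.
move=> A B []?.
  have := @divn_coprime_le 3 (m * t) g isT _ cQg Q0; lia.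
have := @divn_coprime_le 3 (m * s) h isT _ cPh P0; lia.
Qed.

(** * What a single pairing of the generators yields *)

Section Pairing.

Variables (s : seq nat) (a b c e : nat).
Hypothesis (gt1 : [/\ 1 < a, 1 < b, 1 < c & 1 < e]).
Hypothesis (mem_s : [/\ a \in s, b \in s, c \in s & e \in s]).
Hypothesis (cop : [/\ coprime3 a b c, coprime3 a b e,
                      coprime3 c e a & coprime3 c e b]).
Let L := lcmn (lcmn a b) (lcmn c e).

Let gt0 : [/\ 0 < a, 0 < b, 0 < c & 0 < e].
Proof. by case: gt1 => *; split; lia. Qed.

Lemma generated_ge_2lcm m : 2 * L <= m + (a + b + c + e) ->
  generated s m \/ [/\ coprime a b, coprime c e & lcmn a b = lcmn c e].
Proof.
have [a0 b0 c0 e0] := gt0.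
have [i [p [q [lab lce lL [ipq copPQ g6 h6]]]]] := lcm_pair_decomposition gt1 cop.
have [cgh cP cQ] := copPQ.
move: lab lce lL cgh g6 h6 copPQ; set g := gcdn a b; set h := gcdn c e.
move=> lab lce lL cgh g6 h6 copPQ.
have g0 : 0 < g by rewrite gcdn_gt0 a0.
have h0 : 0 < h by rewrite gcdn_gt0 c0.
have [[g1 h1 p1 q1] _|small mL] := lcm_window g0 h0 ipq cgh g6 h6.
  by right; split; [apply/eqP | apply/eqP | rewrite lab lce g1 h1 p1 q1].
(* The congruence modulo [h] makes the complement Y divisible by [h]; since [X] is at most
   [lcmn a b + g * h], [small] keeps Y above [lcmn c e]. *)
left; have [X [X1 X2 gX hX]] :=
  crt_window (m + (a + b + c + e)) (lcmn a b) g0 h0 cgh.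
rewrite /L lL in mL; rewrite lab in X1 X2.
have Xm : X <= m + (a + b + c + e) by lia.
apply: (@generated_split _ a b c e _ X (m + (a + b + c + e) - X)) => //.
- by rewrite subnKC.
- by rewrite lab.
- by rewrite -eqn_mod_dvd ?hX.
- by rewrite lce; lia.
Qed.

Lemma generated_lcm_sub m : m + (a + b + c + e) = L ->
  [\/ generated s m, a = b /\ c = e, coprime a b /\ lcmn a b %| lcmn c e
    | coprime c e /\ lcmn c e %| lcmn a b].
Proof.
have [a0 b0 c0 e0] := gt0.
have [i [p [q [lab lce lL [ipq copPQ g6 h6]]]]] := lcm_pair_decomposition gt1 cop.
have [cgh cP cQ] := copPQ.
move: lab lce lL cgh g6 h6 copPQ; set g := gcdn a b; set h := gcdn c e.
move=> lab lce lL cgh g6 h6 copPQ.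
have g0 : 0 < g by rewrite gcdn_gt0 a0.
have h0 : 0 < h by rewrite gcdn_gt0 c0.
have lcm_gcd_eq x y : lcmn x y = gcdn x y -> x = y.
  move=> lg; apply/eqP; rewrite eqn_dvd.
  rewrite (dvdn_trans (dvdn_lcml x y)) ?lg ?dvdn_gcdr //.
  by rewrite (dvdn_trans (dvdn_lcmr x y)) ?lg ?dvdn_gcdl.
have [[P1 Q1] _|[g1 p1] _|[h1 q1] _|small mL] :=
  floor_window g0 h0 ipq copPQ g6 h6.
- by apply: Or42; split; apply: lcm_gcd_eq; rewrite ?lab ?lce ?P1 ?Q1 muln1.
- apply: Or43; split; first exact/eqP.
  by rewrite lab lce g1 p1 muln1 mul1n dvdn_mull ?dvdn_mulr.
- apply: Or44; split; first exact/eqP.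
  by rewrite lab lce h1 q1 muln1 mul1n dvdn_mull ?dvdn_mulr.
rewrite /L lL in mL; apply: Or41.
have Ph := ltn_ceil (i * p) h0; have Qg := ltn_ceil (i * q) g0.
(* Both [g * h * k] and its complement in [L] are multiples of [g * h], so only the two size
   conditions need work. *)
set k := (i * p %/ h).+1 in Ph.
have kW : g * k + i * q < g * (i * p * q).
  have : g * (k + (i * q %/ g).+1) <= g * (i * p * q) by rewrite leq_mul2l /k; lia.
  by rewrite mulnDr mulnC; lia.
have X1 : lcmn a b < g * h * k by rewrite lab; nia.
have X2 : g * h * k + lcmn c e < g * h * (i * p * q) by rewrite lce; nia.
apply: (@generated_split _ a b c e _ (g * h * k) (g * h * (i * p * q - k))) => //.
- by rewrite mL mulnBr subnKC //; lia.
- by rewrite -mulnA dvdn_mulr.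
- by rewrite mulnAC dvdn_mull.
- by rewrite mulnBr; lia.
Qed.

End Pairing.

(** * Combining the three pairings *)

Lemma coprime_all_dvd_lcm a c e : coprime a c -> coprime a e ->
  a %| lcmn c e -> a = 1.
Proof.
move=> cac cae ace; apply/eqP; rewrite -dvdn1.
have : coprime a (c * e) by rewrite coprimeMr cac.
by move/eqP <-; rewrite dvdn_gcd dvdnn (dvdn_trans ace) // -muln_lcm_gcd dvdn_mulr.
Qed.

Lemma coprime_dvd_lcm a c e : coprime a c -> a %| lcmn c e -> a %| e.
Proof.
move=> cac ace; rewrite -(Gauss_dvdr _ cac) (dvdn_trans ace) //.
by rewrite -muln_lcm_gcd dvdn_mulr.
Qed.

Lemma coprime_triangle_lcm x y z w : 0 < w ->
  coprime x y -> coprime x z -> coprime y z ->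
  lcmn x y %| lcmn z w -> lcmn x z %| lcmn y w ->
  lcmn (lcmn x y) (lcmn z w) <= w.
Proof.
move=> w0 cxy cxz cyz xy_zw xz_yw.
have xw : x %| w.
  by apply: (coprime_dvd_lcm cxz); apply: dvdn_trans (dvdn_lcml _ _) xy_zw.
have yw : y %| w.
  by apply: (coprime_dvd_lcm cyz); apply: dvdn_trans (dvdn_lcmr _ _) xy_zw.
have zw : z %| w.
  apply: (@coprime_dvd_lcm _ y); first by rewrite coprime_sym.
  exact: dvdn_trans (dvdn_lcmr _ _) xz_yw.
by apply: dvdn_leq => //; rewrite !dvdn_lcm xw yw zw dvdnn.
Qed.

Section Quadruple.

Variables (s : seq nat) (a b c e : nat).
Hypothesis (gt1 : [/\ 1 < a, 1 < b, 1 < c & 1 < e]).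
Hypothesis (mem_s : [/\ a \in s, b \in s, c \in s & e \in s]).
Hypothesis (cop : [/\ coprime3 a b c, coprime3 a b e,
                      coprime3 a c e & coprime3 b c e]).
Let L := lcmn (lcmn a b) (lcmn c e).

Let pairings :
  [/\ [/\ coprime3 a b c, coprime3 a b e, coprime3 c e a & coprime3 c e b],
      [/\ coprime3 a c b, coprime3 a c e, coprime3 b e a & coprime3 b e c] &
      [/\ coprime3 a e b, coprime3 a e c, coprime3 b c a & coprime3 b c e]].
Proof.
have C x y z : coprime3 x y z = coprime3 y x z by rewrite /coprime3 gcdnC.
have A x y z : coprime3 x y z = coprime3 x z y.
  by rewrite /coprime3 /coprime gcdnAC.
case: cop => abc abe ace bce.
have [acb aeb aec] : [/\ coprime3 a c b, coprime3 a e b & coprime3 a e c].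
  by split; rewrite A.
by split; split; rewrite // A // C.
Qed.

(** If all three pairings fail, [a] is coprime to [b], [c] and [e], yet it divides [lcmn c e] by the
    equality of lcms, which forces [a = 1]. *)
Lemma generated_ge_2lcm4 m : 2 * L <= m + (a + b + c + e) -> generated s m.
Proof.
have [a1 b1 c1 e1] := gt1; have [as_ bs cs es] := mem_s; have [P1 P2 P3] := pairings.
move=> mL.
have [//|[cab cce lE]] := generated_ge_2lcm gt1 mem_s P1 mL.
have L2 : L = lcmn (lcmn a c) (lcmn b e) by rewrite lcmnACA.
have L3 : L = lcmn (lcmn a e) (lcmn b c) by rewrite lcmnACA [lcmn e c]lcmnC.
have := @generated_ge_2lcm s a c b e (And4 a1 c1 b1 e1)
  (And4 as_ cs bs es) P2 m.
case; [by rewrite -L2; lia | by [] | move=> [cac _ _]].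
have := @generated_ge_2lcm s a e b c (And4 a1 e1 b1 c1)
  (And4 as_ es bs cs) P3 m.
case; [by rewrite -L3; lia | by [] | move=> [cae _ _]].
have aE : a = 1.
  by apply: coprime_all_dvd_lcm cac cae _; rewrite -lE dvdn_lcml.
by move: a1; rewrite aE.
Qed.

Lemma generated_lcm_sub4 m : m + (a + b + c + e) = L ->
  generated s m \/ [\/ a = b /\ c = e, a = c /\ b = e | a = e /\ b = c].
Proof.
have [a1 b1 c1 e1] := gt1; have [as_ bs cs es] := mem_s; have [P1 P2 P3] := pairings.
move=> mL.
have L2 : L = lcmn (lcmn a c) (lcmn b e) by rewrite lcmnACA.
have L3 : L = lcmn (lcmn a e) (lcmn b c) by rewrite lcmnACA [lcmn e c]lcmnC.
have star x y z w : 1 < x -> coprime x y -> coprime x z -> coprime x w ->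
    lcmn x y %| lcmn z w -> False.
  move=> x1 cxy cxz cxw /(dvdn_trans (dvdn_lcml x y)).
  by move/(coprime_all_dvd_lcm cxz cxw) => xE; rewrite xE in x1.
have triangle x y z w : 0 < w -> w < L ->
    coprime x y -> coprime x z -> coprime y z ->
    lcmn x y %| lcmn z w -> lcmn x z %| lcmn y w ->
    L = lcmn (lcmn x y) (lcmn z w) -> False.
  move=> w0 wL cxy cxz cyz d1 d2 LE.
  by have := coprime_triangle_lcm w0 cxy cxz cyz d1 d2; rewrite -LE leqNgt wL.
have [|E|B1|B1] := generated_lcm_sub gt1 mem_s P1 mL.
- by left.
- by right; apply: Or31.
all: have := @generated_lcm_sub s a c b e (And4 a1 c1 b1 e1)
  (And4 as_ cs bs es) P2 m.
all: rewrite -L2 -mL => /(_ ltac:(lia)) [|E|B2|B2];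
  [by left | by right; apply: Or32 | |].
all: have := @generated_lcm_sub s a e b c (And4 a1 e1 b1 c1)
  (And4 as_ es bs cs) P3 m.
all: rewrite -L3 -mL => /(_ ltac:(lia)) [|E|B3|B3];
  [by left | by right; apply: Or33 | |].
(* One coprime pair from each pairing gives eight cases: four stars, one per centre, and four
   triangles, one per omitted generator. *)
all: exfalso; case: B1 B2 B3 => [c1_ d1] [c2 d2] [c3 d3].
- exact: (star a b c e).
- apply: (triangle a b c e) => //; lia.
- by apply: (triangle a b e c) => //; [lia | lia | |]; rewrite [lcmn e c]lcmnC.
- by apply: (star b a c e) => //; rewrite 1?coprime_sym // lcmnC.
- by apply: (triangle a c e b) => //; [lia | lia | | |];
    rewrite ?[lcmn e b]lcmnC // [lcmn c b]lcmnC.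
- by apply: (star c e a b) => //; rewrite coprime_sym.
- by apply: (star e c a b) => //; rewrite 1?coprime_sym // lcmnC.
- apply: (triangle b c e a) => //; [lia | lia | | |].
  + by rewrite [lcmn e a]lcmnC.
  + by rewrite [lcmn c a]lcmnC.
  + by rewrite [lcmn e a]lcmnC lcmnC.
Qed.

End Quadruple.

(** * Assembly of the two claims *)

Import Order.TTheory GRing.Theory Num.Theory.
Local Open Scope ring_scope.

Theorem theoremA (d : 4.-tuple nat)
    (d_pos : forall i : 'I_4, (0 < tnth d i)%N)
    (d_wf : well_formed d) :
  let L : nat := \big[lcmn/1%N]_(i < 4) tnth d i in
  (forall N : int,
     Num.max (2 * L%:Z - \sum_(i < 4) (tnth d i)%:Z) 0 <= N ->
     exists2 m : nat, N = m%:Z & generated d m)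
  /\
  (forall n : nat, (0 < n)%N ->
     (exists2 m : nat,
        n%:Z * L%:Z - \sum_(i < 4) (tnth d i)%:Z = m%:Z & ~ generated d m) ->
     n = 1%N /\ size (undup d) = 2%N).
Proof.
case: d d_pos d_wf => -[|a [|b [|c [|e []]]]] //= sz d_pos d_wf.
have [a0 b0 c0 e0] : [/\ 0 < a, 0 < b, 0 < c & 0 < e]%N.
  by split; [have := d_pos (@Ordinal 4 0 isT) | have := d_pos (@Ordinal 4 1 isT)
    | have := d_pos (@Ordinal 4 2 isT) | have := d_pos (@Ordinal 4 3 isT)];
    rewrite (tnth_nth 0%N).
have cop : [/\ coprime3 a b c, coprime3 a b e, coprime3 a c e & coprime3 b c e].
  split; rewrite /coprime3 /coprime -gcdnA; apply/eqP;
  [have := d_wf (@Ordinal 4 3 isT) | have := d_wf (@Ordinal 4 2 isT)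
  | have := d_wf (@Ordinal 4 1 isT) | have := d_wf (@Ordinal 4 0 isT)];
  by rewrite big_mkcond !big_ord_recl big_ord0 /= !(tnth_nth 0%N) /= ?gcdn0 ?gcd0n.
set L := (\big[_/_]_(i < 4) _)%N.
have LE : L = lcmn (lcmn a b) (lcmn c e).
  by rewrite /L !big_ord_recl big_ord0 !(tnth_nth 0%N) /= lcmn1 lcmnA.
have sumE : \sum_(i < 4) (tnth (@Tuple 4 nat [:: a; b; c; e] sz) i)%:Z =
    (a + b + c + e)%N%:Z.
  rewrite !big_ord_recl big_ord0 !(tnth_nth 0%N) /=; lia.
rewrite sumE; set s := [:: a; b; c; e].
have mem_s : [/\ a \in s, b \in s, c \in s & e \in s].
  by split; rewrite !inE eqxx ?orbT.
have gen1 m : 1%N \in s -> generated s m.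
  by move=> s1; rewrite -[m]muln1; apply: generated_muln.
have gt1 : 1%N \notin s -> [/\ 1 < a, 1 < b, 1 < c & 1 < e]%N.
  by rewrite !inE !negb_or => /and4P[]; split; lia.
have part_i m : (2 * L <= m + (a + b + c + e))%N -> generated s m.
  have [s1 _|/gt1 s1] := boolP (1%N \in s); first exact: gen1.
  by rewrite LE; apply: generated_ge_2lcm4.
split=> [N|n n0 [m mE ngen]].
  rewrite ge_max => /andP[LN N0].
  by exists `|N|%N; [lia | apply: part_i; lia].
(* For [n] at least 2, [n * L] is at least [2 * L], so the first claim applies. *)
have n1 : n = 1%N.
  have [n_gt1|] := ltnP 1 n; last by lia.
  by case: ngen; apply: part_i; nia.
split=> //; have /gt1 s1 : 1%N \notin s by apply/negP => s1; apply: ngen; apply: gen1.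
have mL : (m + (a + b + c + e))%N = lcmn (lcmn a b) (lcmn c e).
  by rewrite -LE; move: mE; rewrite n1; lia.
have [//|two] := generated_lcm_sub4 s1 mem_s cop mL.
(* Three equal generators with gcd 1 would all be 1; hence the two common values of the pairs
   differ. *)
have neq : ~ (a = b /\ b = c).
  move=> [ab bc]; case: cop s1; rewrite /coprime3 -bc -ab gcdnn /coprime gcdnn.
  by move/eqP-> => _ _ _ [].
have two_values (x y : nat) t : perm_eq [:: x; x; y; y] t -> x != y ->
    size (undup t) = 2%N.
  move=> pt xy; have <- : size [:: x; y] = 2%N by [].
  apply: perm_size; apply: uniq_perm => [||z]; rewrite ?undup_uniq //=.
    by rewrite inE xy.
  by rewrite mem_undup -(perm_mem pt) !inE; do 2!case: (_ == _).
rewrite -[X in size X]/(undup s).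
case: two => -[xE yE]; [apply: (@two_values a c) | apply: (@two_values a b)
  | apply: (@two_values a b)].
all: try by apply/eqP => E; apply: neq; lia.
all: by rewrite /s -xE -yE; apply/permP => p /=; lia.
Qed.
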